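(* Assume that the system $x(t+1)=f(x(t),u(t))$ is dissipative with continuous storage function $\lambda:\mathbb{X}\to\mathbb{R}$ with respect to the supply $\ell(x,u)$, i.e. $$\lambda(f(x,u))\le\lambda(x)+\ell(x,u)\qquad\forall\,(x,u)\in\mathbb{Z},$$ and let $\psi(x)=-\lambda(x)$. Then the limit $$\lim_{T\to+\infty}V^{\psi}_T(x)$$ exists for all $x\in\mathbb{X}$, possibly assuming the value $+\infty$.
   Context: Setting. $\mathbb{X}\subset\mathbb{R}^n$ is a nonempty compact set, $\mathbb{Z}\subset\mathbb{X}\times\mathbb{R}^m$ is compact, $f:\mathbb{Z}\to\mathbb{X}$ and $\ell:\mathbb{Z}\to\mathbb{R}$ are continuous. For $x\in\mathbb{X}$, $\mathbb{U}(x):=\{u\in\mathbb{R}^m:(x,u)\in\mathbb{Z}\}$ is nonempty, and $f(x,u)\in\mathbb{X}$ for all $u\in\mathbb{U}(x)$; the set-valued map $\mathbb{U}(\cdot)$ is upper semicontinuous. For a continuous terminal cost $\psi:\mathbb{X}\to\mathbb{R}$ and a horizon $T\in\mathbb{N}$, the finite horizon optimal cost is $$V^\psi_T(x):=\min\Big\{\sum_{t=0}^{T-1}\ell(x(t),u(t))+\psi(x(T))\Big\},$$ the minimum being over all sequences with $x(0)=x$, $x(t+1)=f(x(t),u(t))$ and $(x(t),u(t))\in\mathbb{Z}$ for $t=0,\dots,T-1$, and $x(T)\in\mathbb{X}$. *)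

(* Defs.v *)
From HB Require Import structures.
From mathcomp Require Export all_boot all_order all_algebra.
From mathcomp Require Export all_classical all_reals all_analysis.
Export Order.TTheory GRing.Theory Num.Theory numFieldNormedType.Exports.

Set Implicit Arguments.
Unset Strict Implicit.
Unset Printing Implicit Defensive.

Local Open Scope classical_set_scope.
Local Open Scope ring_scope.

Definition is_minimum (R : realType) (A : set R) (a : R) : Prop :=
  A a /\ lbound A a.

(* Upper semicontinuity in the set-valued sense (via open supersets of F x),
   relative to X; F is unconstrained outside X. *)
Definition set_usc (T S : topologicalType) (X : set T) (F : T -> set S) : Prop :=
  forall x, X x -> forall W : set S, open W -> F x `<=` W ->
    \forall y \near within X (nbhs x), F y `<=` W.

Section OptimalControl.
Context (R : realType) (n m : nat).
Implicit Types (X : set 'rV[R]_n) (Z : set ('rV[R]_n * 'rV[R]_m)).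
Implicit Types (f : 'rV[R]_n * 'rV[R]_m -> 'rV[R]_n).
Implicit Types (l : 'rV[R]_n * 'rV[R]_m -> R).
Implicit Types (psi lam : 'rV[R]_n -> R).

(* The maps f, l (resp. psi, lam) live on Z (resp. X) in the mathematics; here
   they are total functions whose values outside Z (resp. X) are irrelevant. *)

Definition admissible_inputs Z (x : 'rV[R]_n) : set 'rV[R]_m :=
  [set u | Z (x, u)].

(* State and input sequences are indexed by all of nat, but only x 0, ..., x T
   and u 0, ..., u (T - 1) are constrained. *)
Definition feasible X Z f (T : nat) (x0 : 'rV[R]_n)
    (x : nat -> 'rV[R]_n) (u : nat -> 'rV[R]_m) : Prop :=
  [/\ x 0%N = x0,
      forall t, (t < T)%N -> x t.+1 = f (x t, u t) /\ Z (x t, u t)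
    & X (x T)].

Definition horizon_cost l psi (T : nat)
    (x : nat -> 'rV[R]_n) (u : nat -> 'rV[R]_m) : R :=
  \sum_(t < T) l (x t, u t) + psi (x T).

Definition feasible_costs X Z f l psi (T : nat) (x0 : 'rV[R]_n) : set R :=
  [set c | exists x u, feasible X Z f T x0 x u /\ c = horizon_cost l psi T x u].

(* The minimum of the feasible costs. The default value 0 of xget would only be
   taken if there were no minimum; under the standing compactness and
   continuity assumptions the minimum is attained for every x0 in X. *)
Definition optimal_cost X Z f l psi (T : nat) (x0 : 'rV[R]_n) : R :=
  xget 0 [set c | is_minimum (feasible_costs X Z f l psi T x0) c].

Definition dissipative Z f l lam : Prop :=
  forall x u, Z (x, u) -> lam (f (x, u)) <= lam x + l (x, u).

End OptimalControl.

(* Main.v *)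
Require Import Defs.

Local Open Scope classical_set_scope.
Local Open Scope ring_scope.

(** With terminal cost [- lam], dissipativity makes the optimal cost monotone in
the horizon.  Cutting the last step off a trajectory of length [T + 1] leaves a
trajectory of length [T] and lowers the total cost by
[l (x T, u T) + lam (x T) - lam (x (T + 1))], which is nonnegative
([horizon_costS_ge]).  Taking minima over trajectories, the optimal cost is
nondecreasing in [T], so it converges in the extended reals to its supremum,
which is at least the cost of horizon [0] and thus is not [-oo].

Comparing optimal costs in this way requires that the minimum be attained.  By
dynamic programming ([feasible_costsS]), the graph of the set-valued map
sending [x0] to its set of feasible costs for horizon [T + 1] is obtained from
the same graph for horizon [T] and from the compact set [Z] by taking a fibre
product and a continuous image.  Both operations preserve compactness, so by
induction each of these graphs is compact ([compact_cost_graph]), and the costs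
feasible from a given state form a nonempty compact set of reals, which has a
least element ([is_minimum_optimal_cost]). *)

Lemma closed_fst_eq (T S : topologicalType) (a : T) :
  hausdorff_space T -> closed [set p : T * S | p.1 = a].
Proof.
move=> hT; apply: (@preimage_closed _ _ fst [set a]).
  by move=> -[x y] _; exact: cvg_fst.
exact/accessible_closed_set1/hausdorff_accessible.
Qed.

Lemma compact_fst_fiber (T S : topologicalType) (G : set (T * S)) (a : T) :
  hausdorff_space T -> compact G -> compact [set y | G (a, y)].
Proof.
move=> hT cG.
have -> : [set y | G (a, y)] = snd @` (G `&` [set p | p.1 = a]).
  apply/seteqP; split=> [y Gy|_ [[b y] [/= Gby ba] <-]]; last by rewrite -ba.
  by exists (a, y).
apply: continuous_compact.
  by apply: continuous_subspaceT => -[x y]; exact: cvg_snd.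
exact: compact_closedI cG (@closed_fst_eq T S a hT).
Qed.

Lemma compact_is_minimum (R : realType) (A : set R) :
  A !=set0 -> compact A -> exists a, is_minimum A a.
Proof.
move=> A0 cA.
have cid : {within A, continuous (@idfun R)}.
  by apply: continuous_subspaceT => x; exact: cvg_id.
have [a /set_mem Aa amin] := compact_EVT_min A0 cA cid.
by exists a; split=> // b /mem_set /amin.
Qed.

Section OptimalCost.
Context (R : realType) (n m : nat).
Context (X : set 'rV[R]_n) (Z : set ('rV[R]_n * 'rV[R]_m)).
Context (f : 'rV[R]_n * 'rV[R]_m -> 'rV[R]_n).
Context (l : 'rV[R]_n * 'rV[R]_m -> R).

Section FeasibleCosts.
Context (psi : 'rV[R]_n -> R).
Local Notation costs := (feasible_costs X Z f l psi).

Lemma feasible_costs0 (x0 : 'rV[R]_n) :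
  costs 0 x0 = [set c | X x0 /\ c = psi x0].
Proof.
apply/seteqP; split=> [c [x [u [[<- _ Xx] ->]]]|c [Xx0 ->]].
  by rewrite /horizon_cost big_ord0 add0r.
exists (fun=> x0), (fun=> 0).
by rewrite /horizon_cost big_ord0 add0r; split; split.
Qed.

(** A trajectory is its first step followed by a trajectory started at the
successor state. *)
Lemma feasible_costsS (T : nat) (x0 : 'rV[R]_n) :
  costs T.+1 x0 =
  [set c | exists u c',
    [/\ Z (x0, u), costs T (f (x0, u)) c' & c = l (x0, u) + c']].
Proof.
apply/seteqP; split=> c.
  move=> [x [u [[<- step XT] ->]]].
  have [x1 Z0] := step 0%N erefl.
  exists (u 0%N), (horizon_cost l psi T (x \o S) (u \o S)); split=> //.
    exists (x \o S), (u \o S); split=> //; split=> // t tT.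
    exact: (step t.+1).
  by rewrite /horizon_cost big_ord_recl addrA.
move=> [v [_ [Zv [x [u [[x0E step XT] ->]]] ->]]].
exists (fun t => if t is t'.+1 then x t' else x0).
exists (fun t => if t is t'.+1 then u t' else v).
split; last by rewrite /horizon_cost big_ord_recl addrA.
by split=> // -[_|t /step//]; rewrite x0E.
Qed.

Lemma feasible_costs_nonempty (T : nat) (x0 : 'rV[R]_n) :
  (forall x, X x -> admissible_inputs Z x !=set0) ->
  (forall x u, X x -> admissible_inputs Z x u -> X (f (x, u))) ->
  X x0 -> costs T x0 !=set0.
Proof.
move=> U_neq0 f_stable; elim: T x0 => [|T IH] x0 Xx0.
  by exists (psi x0); rewrite feasible_costs0.
have [u Zu] := U_neq0 _ Xx0.
have [c cc] := IH _ (f_stable _ _ Xx0 Zu).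
by exists (l (x0, u) + c); rewrite feasible_costsS; exists u, c.
Qed.

(** The graph for horizon [T + 1] is the image of
[{(z, (y, c)) | Z z, c feasible from y, f z = y}] under
[(z, (y, c)) |-> (z.1, l z + c)].  The constraint [f z = y] involves a map that
is continuous on [Z] only; it is therefore imposed after mapping the whole
product, with [f z - y] kept as an extra first component, so that it becomes a
fibre over [0]. *)
Lemma compact_cost_graph (T : nat) :
  compact X -> compact Z ->
  {within Z, continuous f} -> {within Z, continuous l} ->
  {within X, continuous psi} ->
  compact [set p : 'rV[R]_n * R | costs T p.1 p.2].
Proof.
move=> cX cZ cf cl cpsi; elim: T => [|T IH].
  have -> : [set p : 'rV[R]_n * R | costs 0 p.1 p.2] =
            (fun x => (x, psi x)) @` X.
    apply/seteqP; split=> [[x c]|_ [x Xx <-]] /=; rewrite feasible_costs0 //.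
    by move=> [Xx ->]; exists x.
  apply: continuous_compact cX; apply/subspace_continuousP => x Xx.
  apply: (@cvg_pair _ _ _ _ (nbhs x) (nbhs (psi x))); first exact: cvg_within.
  exact: (proj1 (subspace_continuousP X psi) cpsi x Xx).
pose G := [set p : 'rV[R]_n * R | costs T p.1 p.2].
pose h (q : ('rV[R]_n * 'rV[R]_m) * ('rV[R]_n * R)) :=
  (f q.1 - q.2.1, (q.1.1, l q.1 + q.2.2)).
have -> : [set p : 'rV[R]_n * R | costs T.+1 p.1 p.2] =
          [set p | (h @` (Z `*` G)) (0, p)].
  apply/seteqP; split=> [[x c]|[x c]] /=; rewrite feasible_costsS.
    move=> [u [c' [Zu Gc' ->]]].
    by exists ((x, u), (f (x, u), c')); rewrite // /h /= subrr.
  move=> [[[y u] [y' c']] [/= Zu Gc'] [/eqP]].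
  rewrite subr_eq0 => /eqP fy xy cE.
  by exists u, c'; rewrite -xy fy.
apply: compact_fst_fiber; first exact: norm_hausdorff.
apply: continuous_compact (compact_setX cZ IH).
apply/subspace_continuousP => -[z p] [/= Zz _].
have to_Z : q.1 @[q --> within (Z `*` G) (nbhs (z, p))] --> within Z (nbhs z).
  move=> A ZA.
  have nearA : \forall q \near (z, p), Z q.1 -> A q.1.
    exact: (@cvg_fst _ _ (nbhs z) (nbhs p) _ _ ZA).
  by apply: filterS nearA => q qA [/qA].
have to_p : q.2 @[q --> within (Z `*` G) (nbhs (z, p))] --> p.
  apply: cvg_trans (@cvg_snd _ _ (nbhs z) (nbhs p) _).
  exact: cvg_app (cvg_within _).
have to_z : q.1 @[q --> within (Z `*` G) (nbhs (z, p))] --> z.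
  exact: cvg_trans to_Z (cvg_within _).
have fz := cvg_comp _ _ to_Z (proj1 (subspace_continuousP Z f) cf z Zz).
have lz := cvg_comp _ _ to_Z (proj1 (subspace_continuousP Z l) cl z Zz).
apply: (@cvg_pair _ _ _ _ (nbhs (f z - p.1)) (nbhs (z.1, l z + p.2))).
  by apply: cvgB fz _; apply: cvg_comp to_p _; exact: cvg_fst.
apply: (@cvg_pair _ _ _ _ (nbhs z.1) (nbhs (l z + p.2))).
  by apply: cvg_comp to_z _; exact: cvg_fst.
by apply: cvgD lz _; apply: cvg_comp to_p _; exact: cvg_snd.
Qed.

Lemma is_minimum_optimal_cost (T : nat) (x0 : 'rV[R]_n) :
  compact X -> compact Z ->
  {within Z, continuous f} -> {within Z, continuous l} ->
  {within X, continuous psi} ->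
  (forall x, X x -> admissible_inputs Z x !=set0) ->
  (forall x u, X x -> admissible_inputs Z x u -> X (f (x, u))) ->
  X x0 -> is_minimum (costs T x0) (optimal_cost X Z f l psi T x0).
Proof.
move=> cX cZ cf cl cpsi U_neq0 f_stable Xx0.
have costs_neq0 := feasible_costs_nonempty T x0 U_neq0 f_stable Xx0.
have costs_compact := compact_fst_fiber _ _ _ x0 (@norm_hausdorff _ 'rV[R]_n)
  (compact_cost_graph T cX cZ cf cl cpsi).
apply: (xgetPex 0 (P := [set c | is_minimum (costs T x0) c])).
exact: compact_is_minimum _ _ costs_neq0 costs_compact.
Qed.

End FeasibleCosts.

Lemma feasible_truncate (T : nat) (x0 : 'rV[R]_n) x u :
  Z `<=` X `*` setT ->
  feasible X Z f T.+1 x0 x u -> feasible X Z f T x0 x u.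
Proof.
move=> Z_sub [x0E step _]; split=> // [t tT|]; first exact/step/ltnW.
by have [_ /Z_sub[]] := step T (ltnSn T).
Qed.

(** The terminal costs [- lam] telescope: the extra step costs [l (x T, u T)]
and moves the terminal cost from [- lam (x T)] to [- lam (x T.+1)]. *)
Lemma horizon_costS_ge (lam : 'rV[R]_n -> R) (T : nat) (x0 : 'rV[R]_n) x u :
  dissipative Z f l lam -> feasible X Z f T.+1 x0 x u ->
  horizon_cost l (fun y => - lam y) T x u <=
  horizon_cost l (fun y => - lam y) T.+1 x u.
Proof.
move=> diss [_ step _]; have [xE ZT] := step T (ltnSn T).
rewrite /horizon_cost big_ord_recr /= -addrA lerD2l xE.
by rewrite lerBrDl lerBlDl diss.
Qed.

End OptimalCost.

Theorem proposition2p1 (R : realType) (n m : nat)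
    (X : set 'rV[R]_n) (Z : set ('rV[R]_n * 'rV[R]_m))
    (f : 'rV[R]_n * 'rV[R]_m -> 'rV[R]_n) (l : 'rV[R]_n * 'rV[R]_m -> R)
    (X_neq0 : X !=set0) (X_compact : compact X)
    (Z_sub : Z `<=` X `*` setT) (Z_compact : compact Z)
    (f_cont : {within Z, continuous f}) (l_cont : {within Z, continuous l})
    (U_neq0 : forall x, X x -> admissible_inputs Z x !=set0)
    (f_stable : forall x u, X x -> admissible_inputs Z x u -> X (f (x, u)))
    (U_usc : set_usc X (admissible_inputs Z))
    (lam : 'rV[R]_n -> R) (lam_cont : {within X, continuous lam})
    (diss : dissipative Z f l lam) :
  forall x, X x ->
    exists L : \bar R, L <> -oo%E /\
      (optimal_cost X Z f l (fun y => - lam y) T x)%:E @[T --> \oo] --> L.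
Proof.
move=> x0 Xx0.
have Nlam_cont : {within X, continuous (fun y => - lam y)}.
  by move=> y; apply: cvgN; exact: lam_cont.
pose V T := optimal_cost X Z f l (fun y => - lam y) T x0.
have Vmin T : is_minimum (feasible_costs X Z f l (fun y => - lam y) T x0) (V T).
  exact: is_minimum_optimal_cost.
have V_homo : {homo V : S T / (S <= T)%N >-> S <= T}.
  apply: homo_leq => [//||T]; first exact: le_trans.
  have [[x [u [feas ->]]] _] := Vmin T.+1.
  apply: le_trans; last exact: horizon_costS_ge diss feas.
  apply: (Vmin T).2; exists x, u; split=> //.
  exact: feasible_truncate Z_sub feas.
exists (ereal_sup (range (EFin \o V))); split; last first.
  by apply: ereal_nondecreasing_cvgn => S T ST; rewrite lee_fin V_homo.
apply/eqP; rewrite -ltNye; apply: lt_le_trans (ltNyr (V 0%N)) _.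
by apply: ereal_sup_ubound; exists 0%N.
Qed.
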